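(* For every $m\in\mathbb{N}$ there exists a class of functions $\mathcal{F}_m^*\subset L^1([0,\infty))$ such that $$w(\Lambda_1^*|\mathcal{F}_1^* )\ge 1.38\qquad\text{and}\qquad \liminf_{m\to\infty} w(\Lambda_m^*|\mathcal{F}_m^* )\ge 1.37.$$
   Context: $\mathbb{N}=\{1,2,3,\dots\}$; $|\cdot|$ applied to a set denotes Lebesgue measure. For $m\in\mathbb{N}$ the operator $\Lambda_m^*$ acts on $f\in L^1([0,\infty))$ by $$\Lambda_m^* f(t)=(1+m)\,t^{m/2}\int_t^\infty \frac{f(s)\,ds}{s^{1+m/2}}-f(t),\qquad t>0 .$$ For an operator $T$ acting on $L^1([0,\infty))$ and a class $\mathcal{F}\subset L^1([0,\infty))$, the restricted weak-type $(1,1)$ constant is $$w(T|\mathcal{F})=\sup\Bigl\{\frac{|\{t\in[0,\infty):|Tf(t)|\ge 1\}|}{\|f\|_{L^1([0,\infty))}}: f\in\mathcal{F},\ \|f\|_{L^1([0,\infty))}\ne 0\Bigr\}.$$ *)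

(* Defs.v *)
From HB Require Import structures.
From mathcomp Require Import all_boot all_order all_algebra.
From mathcomp Require Import all_classical all_reals all_analysis.

Set Implicit Arguments.
Unset Strict Implicit.
Unset Printing Implicit Defensive.

Import Order.TTheory GRing.Theory Num.Theory.
Import numFieldNormedType.Exports.

Local Open Scope classical_set_scope.
Local Open Scope ring_scope.

(* Elements of L^1([0, oo)) are represented by functions R -> R; their values
   on the negative half-line are irrelevant everywhere below. *)
Definition L1 (R : realType) : set (R -> R) :=
  [set f | (@lebesgue_measure R).-integrable `[0, +oo[ (EFin \o f)].

Definition L1norm (R : realType) (f : R -> R) : \bar R :=
  (\int[@lebesgue_measure R]_(x in `[0%R, +oo[) `|f x|%:E)%E.

(* The formula is meant for t > 0; the value at the single point t = 0 does not
   affect [weak_const]. For f in L1 and t > 0 the integral converges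
   absolutely, so [Rintegral] is the genuine value. *)
Definition Lambda_star (R : realType) (m : nat) (f : R -> R) (t : R) : R :=
  (1 + m%:R) * t `^ (m%:R / 2) *
    (\int[@lebesgue_measure R]_(s in `[t, +oo[) (f s / s `^ (1 + m%:R / 2)))
  - f t.

Definition weak_const (R : realType) (T : (R -> R) -> R -> R)
    (F : set (R -> R)) : \bar R :=
  ereal_sup
    [set ((@lebesgue_measure R) [set t : R | (0 <= t)%R /\ (1 <= `|T f t|)%R]
          / L1norm f)%E | f in [set f | F f /\ L1norm f != 0%E]].

(* Main.v *)
(* The integral in [Lambda_star m f t] only sees [f] on [[t, oo)], so a step
   function can be built from right to left while keeping |Lambda_star m f| >= 1
   on everything built so far. With a = m/2, let G(t) = Lambda_star m f t + f t.
   Where f = 0, G is proportional to t^a and the requirement is G >= 1. Where f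
   is a constant c, G increases as t decreases, and Lambda_star m f <= -1
   requires G <= c - 1.
   Start from a block of height 2 on [1, T), with T chosen so that G(1) = 1.
   Then repeat, to the left, a block of height 1 + E raising G from 1 to E and a
   gap bringing G back to 1; the period is multiplicative, so the good set
   exhausts (0, T). For E close to 1 only a small proportion of each period is
   charged: E = 11/10 gives a ratio of about 1.45 for m = 1 and of about 1.9 as
   m tends to infinity. *)
Require Import Defs.
From HB Require Import structures.
From mathcomp Require Import all_boot all_order all_algebra.
From mathcomp Require Import all_classical all_reals all_analysis.
From mathcomp Require Import measurable_realfun lra.
Set Implicit Arguments.
Unset Strict Implicit.
Unset Printing Implicit Defensive.
Import Order.TTheory GRing.Theory Num.Theory.
Import numFieldNormedType.Exports.
Local Open Scope classical_set_scope.
Local Open Scope ring_scope.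

(** * Integrals of powers and monotonicity of the measure *)

Lemma continuous_powR (R : realType) (p x : R) :
  0 < x -> {for x, continuous (fun y : R => y `^ p)}.
Proof.
move=> x0; apply: differentiable_continuous; apply/derivable1_diffP.
by case: (@is_derive1_powR R p x x0).
Qed.

(** Outer measures are monotone on arbitrary sets, so the set where |Lambda_star f| >= 1 can be
    bounded below without proving it measurable. *)
Lemma lebesgue_measure_le (R : realType) (A B : set R) :
  A `<=` B -> (lebesgue_measure A <= lebesgue_measure B)%E.
Proof.
move=> AB; rewrite /lebesgue_measure /= /lebesgue_stieltjes_measure /=.
by rewrite /measure_extension /=; exact: le_outer_measure.
Qed.

Lemma integral_powRN (R : realType) (a c x y : R) : 0 < a -> 0 < x -> x <= y ->
  (\int[lebesgue_measure]_(s in `[x, y[) (c / s `^ (1 + a))%:E =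
   (c * (x `^ (- a) - y `^ (- a)) / a)%:E)%E.
Proof.
move=> a0 x0; rewrite le_eqVlt => /predU1P[<-|xy].
  by rewrite subrr mulr0 mul0r set_itvco0 integral_set0.
have y0 : 0 < y by exact: lt_trans xy.
pose f (s : R) := c * s `^ (- (1 + a)).
pose F (s : R) := - (c / a) * s `^ (- a).
under eq_integral do rewrite -powRN -/(f _).
have cf (s : R) : 0 < s -> {for s, continuous f}.
  by move=> s0; apply: cvgM; [exact: cvg_cst | exact: continuous_powR].
have cF (s : R) : 0 < s -> {for s, continuous F}.
  by move=> s0; apply: cvgM; [exact: cvg_cst | exact: continuous_powR].
have mf : measurable_fun setT f.
  by apply: measurable_funM => //; exact: measurable_powR.
rewrite integral_itv_bndo_bndc; last first.
  by apply/measurable_EFinP; exact: measurable_funS mf.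
rewrite (@continuous_FTC2 _ f F) //.
- by rewrite /F -EFinB; congr EFin; lra.
- apply/continuous_within_itvP => //; split.
  + by move=> s; rewrite in_itv/= => /andP[xs _]; apply/cf/(lt_trans x0).
  + by apply: cvg_at_right_filter; exact: cf.
  + by apply: cvg_at_left_filter; exact: cf.
- split.
  + move=> s; rewrite in_itv/= => /andP[xs _].
    have [? _] := @is_derive1_powR R (- a) s (lt_trans x0 xs).
    exact: derivableM.
  + by apply: cvg_at_right_filter; exact: cF.
  + by apply: cvg_at_left_filter; exact: cF.
- move=> s; rewrite in_itv/= => /andP[xs _].
  have [h e] := @is_derive1_powR R (- a) s (lt_trans x0 xs).
  rewrite derive1E /F deriveM //= e derive_cst scaler0 addr0 /f.
  rewrite -[_ *: _]/(_ * _) (_ : - a - 1 = - (1 + a)); last by lra.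
  by rewrite mulrA mulrNN divfK ?gt_eqF.
Qed.

Lemma ge0_integral_itvcy_split (R : realType) (h : R -> R) (t t0 : R) :
  measurable_fun setT h -> (forall s, 0 <= h s) -> t <= t0 ->
  (\int[lebesgue_measure]_(s in `[t, +oo[) (h s)%:E =
   \int[lebesgue_measure]_(s in `[t, t0[) (h s)%:E +
   \int[lebesgue_measure]_(s in `[t0, +oo[) (h s)%:E)%E.
Proof.
move=> mh h0 tt0.
have -> : `[t, +oo[%classic = `[t, t0[ `|` `[t0, +oo[ :> set R.
  apply/seteqP; split => s /=; rewrite !in_itv/= !andbT.
    by move=> ->; case: (ltP s t0); [left | right].
  by case=> [/andP[]//|]; exact: le_trans.
rewrite ge0_integral_setU//=.
- by apply/measurable_EFinP; exact: measurable_funS mh.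
- by move=> s _; rewrite lee_fin.
- apply/disj_setPS => s /=; rewrite !in_itv/= andbT => -[/andP[_ st0]].
  by rewrite leNgt st0.
Qed.

(** * Step functions built from right to left *)

(* [J] is the value at [t0] of the integral in [Lambda_star], and [M] the norm. *)
Definition profile (R : realType) (m : nat) (f : R -> R) (t0 T J M : R) : Prop :=
  [/\ measurable_fun setT f,
      (forall s, 0 <= f s) /\ (forall s, s < t0 -> f s = 0),
      (\int[lebesgue_measure]_(s in `[t0, +oo[)
         (f s / s `^ (1 + m%:R / 2))%:E = J%:E)%E,
      (\int[lebesgue_measure]_(s in `[t0, +oo[) (f s)%:E = M%:E)%E &
      forall t, t0 <= t < T -> 1 <= `|Lambda_star m f t|].

Lemma profile_nil (R : realType) (m : nat) (T : R) :
  profile m (cst 0 : R -> R) T T 0 0.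
Proof.
split=> //.
- by apply: integral0_eq => s _; rewrite mul0r.
- exact: integral0_eq.
- by move=> t /andP[/le_lt_trans h /h]; rewrite ltxx.
Qed.

(** To the right of [t0] nothing changes, since the operator looks only to the right. On [[u, t0)]
    the tail integral has a closed form, and the last hypothesis is the desired bound written with
    it. A gap is the case [c = 0]. *)
Lemma profile_cons (R : realType) (m : nat) (f : R -> R) (u t0 T J M c : R) :
  let a : R := m%:R / 2 in
  (0 < m)%N -> 0 < u -> u <= t0 -> 0 <= c ->
  profile m f t0 T J M ->
  (forall t, u <= t < t0 ->
    1 <= `|(1 + m%:R) * t `^ a * (J + c * (t `^ (- a) - t0 `^ (- a)) / a) - c|) ->
  exists g, profile m g u T (J + c * (u `^ (- a) - t0 `^ (- a)) / a)
                            (M + c * (t0 - u)).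
Proof.
move=> a m0 u0 ut0 c0 [mf [f0 fz] fJ fM fL] hc.
have a0 : 0 < a by rewrite divr_gt0 ?ltr0n.
pose g (s : R) := f s + c * \1_(`[u, t0[%classic) s.
have gl s : u <= s < t0 -> g s = c.
  move=> /andP[us st0]; rewrite /g fz// indicE mem_set/= ?in_itv/= ?us//.
  by rewrite mulr1 add0r.
have gr s : t0 <= s -> g s = f s.
  move=> t0s; rewrite /g indicE memNset/= ?mulr0 ?addr0// in_itv/=.
  by rewrite [s < t0]ltNge t0s andbF.
have mg : measurable_fun setT g.
  by apply: measurable_funD => //; apply: measurable_funM.
have g0 s : 0 <= g s by rewrite addr_ge0// mulr_ge0.
(* One splitting serves twice: the weight [s^-(1+a)] gives [J], the weight 1 gives the norm. *)
have split_g (w : R -> R) (t : R) : measurable_fun setT w ->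
    (forall s, 0 <= w s) -> u <= t -> t <= t0 ->
    (\int[lebesgue_measure]_(s in `[t, +oo[) (g s * w s)%:E =
     \int[lebesgue_measure]_(s in `[t, t0[) (c * w s)%:E +
     \int[lebesgue_measure]_(s in `[t0, +oo[) (f s * w s)%:E)%E.
  move=> mw w0 ut tt0; rewrite (@ge0_integral_itvcy_split _ _ _ t0)//.
  - congr (_ + _)%E; apply: eq_integral => s; rewrite inE/= in_itv/=.
      by move=> /andP[ts st0]; rewrite gl// st0 (le_trans ut).
    by rewrite andbT => /gr ->.
  - exact: measurable_funM.
  - by move=> s; rewrite mulr_ge0.
have gJ t : u <= t -> t <= t0 ->
  (\int[lebesgue_measure]_(s in `[t, +oo[) (g s / s `^ (1 + a))%:E =
    (J + c * (t `^ (- a) - t0 `^ (- a)) / a)%:E)%E.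
  move=> ut tt0; rewrite (split_g (fun s => (s `^ (1 + a))^-1))//.
  - by rewrite fJ integral_powRN ?(lt_le_trans u0 ut)// addrC.
  - under [X in measurable_fun _ X]eq_fun do rewrite -powRN.
    exact: measurable_powR.
  - by move=> s; rewrite invr_ge0 powR_ge0.
exists g; split => //.
- split=> // s su; rewrite /g fz ?(lt_le_trans su)// indicE memNset/= ?mulr0 ?addr0//.
  by rewrite in_itv/= leNgt su.
- exact: gJ.
- under eq_integral do rewrite -[g _]mulr1.
  rewrite (split_g (cst 1))//.
  have -> : (fun s : R => (f s * cst 1 s)%:E) = EFin \o f.
    by apply/funext => s /=; rewrite mulr1.
  have -> : (fun s : R => (c * cst 1 s)%:E) = cst c%:E.
    by apply/funext => s /=; rewrite mulr1.
  rewrite fM integral_cst//= lebesgue_measure_itv/= lte_fin.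
  case: ltP => [_|t0u]; first by rewrite -EFinB -EFinM -EFinD addrC.
  have -> : t0 = u by apply/eqP; rewrite eq_le t0u ut0.
  by rewrite mule0 add0e subrr mulr0 addr0.
- move=> t /andP[ut tT]; have [t0t|tt0] := leP t0 t.
    have := fL t; rewrite t0t tT => /(_ isT); rewrite /Lambda_star gr//.
    rewrite /Rintegral; congr (_ <= `|_ * fine _ - _|); apply/esym/eq_integral.
    by move=> s; rewrite inE/= in_itv/= andbT => ts; rewrite gr// (le_trans t0t).
  rewrite /Lambda_star /Rintegral gJ// ?(ltW tt0)//= gl ?ut//.
  by apply: hc; rewrite ut.
Qed.

(** The good set contains [[t0, T)], and [f] vanishes to the left of [t0], so [M] is its full
    norm. *)
Lemma weak_const_ge_profile (R : realType) (m : nat) (f : R -> R) (t0 T J M : R) :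
  0 < t0 -> t0 <= T -> 0 < M -> profile m f t0 T J M ->
  (((T - t0) / M)%:E <= weak_const (@Lambda_star R m) (@L1 R))%E.
Proof.
move=> t00 t0T M0 [mf [f0 fz] _ fM fL].
have fM0 : (\int[lebesgue_measure]_(s in `[0%R, +oo[) (f s)%:E)%E = M%:E.
  rewrite (@ge0_integral_itvcy_split _ _ _ t0) ?ltW//.
  rewrite integral0_eq ?add0e ?fM// => s /=.
  by rewrite in_itv/= => /andP[_ st0]; rewrite fz.
have fn : L1norm f = M%:E.
  by rewrite -fM0; apply: eq_integral => s _; rewrite ger0_norm.
have fL1 : L1 f.
  apply/integrableP; split; first by apply/measurable_EFinP; exact: measurable_funS mf.
  rewrite (_ : (fun _ => _) = (fun s => `|f s|%:E)) ?[ltLHS]fn ?ltry//.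
pose S := [set t : R | 0 <= t /\ 1 <= `|Lambda_star m f t|].
have : (lebesgue_measure S / M%:E
    <= weak_const (@Lambda_star R m) (@L1 R))%E.
  apply: ereal_sup_ubound; exists f => /=; rewrite fn//.
  by split => //; rewrite eqe gt_eqF.
apply: le_trans; rewrite inver gt_eqF// EFinM lee_pmul2r ?lte_fin ?invr_gt0//.
have <- : lebesgue_measure (`[t0, T[%classic : set R) = (T - t0)%:E.
  rewrite lebesgue_measure_itv/= lte_fin; case: ltgtP t0T => // -> _.
  by rewrite subrr.
apply: lebesgue_measure_le => t /=; rewrite in_itv/= => tT; split; last exact: fL.
by case/andP: tT => h _; apply: le_trans h; exact: ltW.
Qed.

(** * One block and one gap *)

(* [G] is the value at [t0] of [Lambda_star m f + f]. *)
Lemma profile_block (R : realType) (m : nat) (f : R -> R) (u t0 T G G' M : R) :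
  let a : R := m%:R / 2 in let k : R := (1 + m%:R) / a in
  (0 < m)%N ->
  0 < u <= 1 -> 0 < t0 -> 0 <= G' -> G <= k * (1 + G') ->
  G' = k * (1 + G') - (k * (1 + G') - G) * u `^ a ->
  profile m f t0 T (G * t0 `^ (- a) / (1 + m%:R)) M ->
  exists g, profile m g (u * t0) T (G' * (u * t0) `^ (- a) / (1 + m%:R))
                    (M + (1 + G') * (t0 - u * t0)).
Proof.
move=> a k m0 /andP[u0 u1] t00 G'0 Gk G'E fp.
have a0 : 0 < a by rewrite divr_gt0 ?ltr0n.
have n0 : 0 < 1 + m%:R :> R by rewrite ltr_wpDr.
have Q0 : 0 < t0 `^ a by exact: powR_gt0.
have U0 : 0 < u `^ a by exact: powR_gt0.
pose c := 1 + G'.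
(* With [P = t^a], this is the value of [Lambda_star + f] on the block:
   [k c - (k c - G) (t/t0)^a]. *)
have gJ P : 0 < P -> (1 + m%:R) * P *
    (G * (t0 `^ a)^-1 / (1 + m%:R) + c * (P^-1 - (t0 `^ a)^-1) / a) =
    k * c - (k * c - G) * (P / t0 `^ a).
  move=> P0; transitivity (G * (P / t0 `^ a) * ((1 + m%:R) / (1 + m%:R)) +
     c * k * (P / P - P / t0 `^ a)); first by rewrite /k; lra.
  by rewrite !divff ?gt_eqF//; lra.
have [] := @profile_cons R m f (u * t0) t0 T _ M c m0 _ _ _ fp.
- exact: mulr_gt0.
- by rewrite ger_pMl.
- by rewrite addr_ge0.
- move=> t /andP[utt tt0].
  have t'0 : 0 < t by apply: lt_le_trans utt; exact: mulr_gt0.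
  rewrite !powRN gJ ?powR_gt0//.
  have : u `^ a <= t `^ a / t0 `^ a.
    rewrite ler_pdivlMr// -powRM ?(ltW u0) ?(ltW t00)//.
    by apply: (ge0_ler_powR (ltW a0)) => //; rewrite nnegrE ltW// mulr_gt0.
  have : 0 <= k * c - G by rewrite subr_ge0.
  move=> h1 h2; have := ler_wpM2l h1 h2.
  rewrite -/c in G'E; move: G'E; rewrite {2}/c => G'E h3.
  (* That value is largest at the left end, where it is [G']; subtracting the height [1 + G'] leaves
     at most -1. *)
  rewrite ler0_norm; rewrite /c in G'E h3 *; lra.
- move=> g gp; exists g; move: gp; rewrite -/a -/c !powRN.
  have P0 : 0 < (u * t0) `^ a by rewrite powR_gt0// mulr_gt0.
  have PE : (u * t0) `^ a / t0 `^ a = u `^ a.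
    by rewrite powRM ?(ltW u0) ?(ltW t00)// mulfK ?gt_eqF.
  have := gJ _ P0; rewrite PE -/c -G'E => <-.
  move: (G * _ / _ + _) => X.
  by rewrite [_ * X]mulrC mulrA mulfK ?gt_eqF// mulfK ?gt_eqF.
Qed.

(** Where the function is zero, [Lambda_star] is [G (t/t0)^a], which falls to exactly 1 at
    [t = w t0]. *)
Lemma profile_gap (R : realType) (m : nat) (f : R -> R) (w t0 T G M : R) :
  let a : R := m%:R / 2 in (0 < m)%N ->
  0 < w <= 1 -> 0 < t0 -> G * w `^ a = 1 ->
  profile m f t0 T (G * t0 `^ (- a) / (1 + m%:R)) M ->
  exists g, profile m g (w * t0) T ((w * t0) `^ (- a) / (1 + m%:R)) M.
Proof.
move=> a m0 /andP[w0 w1] t00 Gw fp.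
have a0 : 0 < a by rewrite divr_gt0 ?ltr0n.
have n0 : 0 < 1 + m%:R :> R by rewrite ltr_wpDr.
have Q0 : 0 < t0 `^ a by exact: powR_gt0.
have W0 : 0 < w `^ a by exact: powR_gt0.
have G0 : 0 < G by rewrite -(pmulr_lgt0 _ W0) Gw.
have [] := @profile_cons R m f (w * t0) t0 T _ M 0 m0 _ _ _ fp => //.
- exact: mulr_gt0.
- by rewrite ger_pMl.
- move=> t /andP[wtt tt0].
  rewrite mul0r mul0r addr0 subr0 -/a powRN.
  have -> : (1 + m%:R) * t `^ a * (G * (t0 `^ a)^-1 / (1 + m%:R)) =
      G * (t `^ a / t0 `^ a).
    by rewrite mulrC -!mulrA mulKf ?gt_eqF// [_^-1 * _]mulrC.
  have : w `^ a <= t `^ a / t0 `^ a.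
    rewrite ler_pdivlMr// -powRM ?(ltW w0) ?(ltW t00)//.
    apply: (ge0_ler_powR (ltW a0)) => //; rewrite nnegrE ltW ?mulr_gt0//.
    by apply: lt_le_trans wtt; exact: mulr_gt0.
  by move=> /(ler_wpM2l (ltW G0)); rewrite Gw => /le_trans; apply; exact: ler_norm.
- move=> g; rewrite !mul0r !addr0 -/a => gp; exists g; move: gp.
  rewrite !powRN powRM ?(ltW w0) ?(ltW t00)// invfM.
  by have -> : (w `^ a)^-1 = G by rewrite -[G](mulfK (lt0r_neq0 W0)) Gw mul1r.
Qed.

(** * Iterating the period and letting the number of periods grow *)

(* A block of height [1 + E] spans the ratio [u], the gap after it the ratio [w];
   [T] is the right end of the initial block [[1, T)]. *)
Definition schedule (R : realType) (m : nat) (E u w T : R) : Prop :=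
  let a : R := m%:R / 2 in let k : R := (1 + m%:R) / a in
  [/\ (0 < m)%N /\ 1 <= E, 0 < u < 1 /\ 0 < w <= 1, 1 < T,
      E = k * (1 + E) - (k * (1 + E) - 1) * u `^ a /\ E * w `^ a = 1 &
      1 = k * 2 - k * 2 * T `^ (- a)].

(** Every period starts and ends with G = 1, so it is the previous one scaled by [w * u], and the
    masses added form a geometric sum. *)
Lemma profile_periods (R : realType) (m : nat) (E u w T : R) (N : nat) :
  schedule m E u w T ->
  exists f, profile m f ((w * u) ^+ N) T
    (((w * u) ^+ N) `^ (- (m%:R / 2)) / (1 + m%:R))
    (2 * (T - 1) + (1 + E) * (1 - u) / (1 - w * u) * (1 - (w * u) ^+ N)).
Proof.
rewrite /schedule; set a : R := m%:R / 2; set k := (_ / a).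
move=> [[m0 E1] [/[dup] u01 /andP[u0 u1] /[dup] w01 /andP[w0 w1]] T1 [uE wE] TE].
have k2 : 2 <= k.
  by rewrite /k /a invf_div mulrA ler_pdivlMr ?ltr0n// [_ * 2]mulrC ler_pM2l ?lerDr.
have T0 : 0 < T by lra.
elim: N => [|N [f fp]].
  (* Initial block: G rises from 0 at [T] to 1 at the point 1, hence height 2. *)
  have [] := @profile_block R m (cst 0) T^-1 T T 0 1 0 m0 _ T0 _ _ _ _.
  - by rewrite invr_gt0 T0 invf_le1// ltW.
  - by [].
  - by rewrite mulr_ge0// ?addr_ge0//; lra.
  - by rewrite subr0 -(powR_inv1 (ltW T0)) -powRrM mulN1r.
  - by rewrite !mul0r; exact: profile_nil.
  move=> f; rewrite mulVf ?gt_eqF// mul1r add0r => fp; exists f.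
  by rewrite expr0 subrr mulr0 addr0.
have t0 : 0 < (w * u) ^+ N by rewrite exprn_gt0// mulr_gt0.
have kE : 1 <= k * (1 + E).
  by have := @ler_pM _ 2 k 1 (1 + E); lra.
rewrite -[_ `^ _]mul1r in fp.
have [] := profile_block m0 _ t0 _ kE uE fp; first by rewrite u0 ltW.
  by lra.
move=> g gp.
have [] := profile_gap m0 w01 _ wE gp; first exact: mulr_gt0.
move=> h; rewrite mulrA -exprS => hp; exists h; move: hp.
congr profile; rewrite exprS.
have wu : w * u < 1 by apply: le_lt_trans u1; rewrite ger_pMl.
have : (1 - w * u) / (1 - w * u) = 1 by rewrite divff// subr_eq0 gt_eqF.
move: ((w * u) ^+ N) ((1 - w * u)^-1) => X Y XY.
transitivity (2 * (T - 1) + (1 + E) * (1 - u) * Y * (1 - X) +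
  (1 + E) * (1 - u) * X * ((1 - w * u) * Y)).
  by rewrite XY; lra.
by lra.
Qed.

Lemma weak_const_ge_schedule (R : realType) (m : nat) (E u w T q : R) :
  schedule m E u w T -> 0 <= q ->
  q * ((1 + E) * (1 - u) + 2 * (T - 1) * (1 - w * u)) < T * (1 - w * u) ->
  (q%:E <= weak_const (@Lambda_star R m) (@L1 R))%E.
Proof.
move=> sch q0 qT.
have [[m0 E1] [/andP[u0 u1] /andP[w0 w1]] T1 _ _] := sch.
have wu0 : 0 < w * u by exact: mulr_gt0.
have wu1 : w * u < 1 by apply: le_lt_trans u1; rewrite ger_pMl.
(* [C] is the limiting norm; the good set tends to [(0, T)]. The strict hypothesis says [q * C < T],
   and this slack absorbs the uncovered [(0, (w * u)^N)]. *)
pose C := (1 + E) * (1 - u) / (1 - w * u) + 2 * (T - 1).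
have qC : q * C < T.
  rewrite -(@ltr_pM2r _ (1 - w * u)) ?subr_gt0// -mulrA mulrDl divfK//.
  by rewrite subr_eq0 gt_eqF.
have [N NC] : exists N, (w * u) ^+ N < T - q * C.
  have : (w * u) ^+ n @[n --> \oo] --> (0 : R).
    by apply: cvg_expr; rewrite ger0_norm// ltW.
  move=> /cvgrPdist_lt/(_ (T - q * C)); rewrite subr_gt0 => /(_ qC)[N _ h].
  exists N; have := h N (leqnn N); rewrite sub0r normrN ger0_norm//.
  by rewrite exprn_ge0// ltW.
have [f fp] := profile_periods N sch.
have X0 : 0 < (w * u) ^+ N by rewrite exprn_gt0.
have X1 : (w * u) ^+ N <= 1 by rewrite exprn_ile1// ltW.
have D0 : 0 <= (1 + E) * (1 - u) / (1 - w * u).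
  by rewrite divr_ge0 ?mulr_ge0//; lra.
have := weak_const_ge_profile X0 _ _ fp; move: fp => _.
move: ((1 + E) * (1 - u) / (1 - w * u)) @C qC NC D0 => D C qC NC D0.
move: ((w * u) ^+ N) X0 X1 NC => X X0 X1 NC h.
have DX : 0 <= D * X by rewrite mulr_ge0// ltW.
have M0 : 0 < 2 * (T - 1) + D * (1 - X).
  by have : 0 <= D * (1 - X) by [rewrite mulr_ge0//; lra]; lra.
apply: le_trans (h _ M0); last by lra.
rewrite lee_fin ler_pdivlMr//.
have : q * (2 * (T - 1) + D * (1 - X)) <= q * C.
  by apply: ler_wpM2l => //; rewrite /C; lra.
by lra.
Qed.

(** * Explicit parameters and numerical bounds *)

Lemma powR_lt1 (R : realType) (x p : R) : 0 < x < 1 -> 0 < p -> 0 < x `^ p < 1.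
Proof.
move=> /andP[x0 x1] p0; rewrite powR_gt0//=.
suff : x `^ p < 1 `^ p by rewrite powR1.
by apply: (gt0_ltr_powR p0) => //; rewrite nnegrE ltW.
Qed.

Lemma powRVK (R : realType) (x p : R) : 0 < x -> 0 < p -> (x `^ p^-1) `^ p = x.
Proof. by move=> x0 p0; rewrite -powRrM mulVf ?gt_eqF// powRr1// ltW. Qed.

(** For E = 11/10 the schedule equations are linear in [u^a], [w^a] and [T^-a]; solving them and
    taking roots gives the three values. *)
Lemma schedule_powR (R : realType) (m : nat) :
  let a : R := m%:R / 2 in let k : R := (1 + m%:R) / a in
  (0 < m)%N ->
  schedule m (11 / 10)
    (((k * (21 / 10) - 11 / 10) / (k * (21 / 10) - 1)) `^ a^-1)
    ((10 / 11) `^ a^-1) ((1 - (2 * k)^-1) `^ (- a^-1)).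
Proof.
move=> a k m0.
have a0 : 0 < a by rewrite divr_gt0 ?ltr0n.
have k2 : 2 <= k.
  by rewrite /k /a invf_div mulrA ler_pdivlMr ?ltr0n// [_ * 2]mulrC ler_pM2l ?lerDr.
have h0 : 0 < (2 * k)^-1 by rewrite invr_gt0; lra.
have h1 : (2 * k)^-1 < 1 by rewrite invf_lt1; lra.
have U0 : 0 < (k * (21 / 10) - 11 / 10) / (k * (21 / 10) - 1).
  by rewrite divr_gt0//; lra.
have z01 : 0 < 1 - (2 * k)^-1 < 1 by lra.
rewrite /schedule -/a -/k; split.
- by split => //; lra.
- split.
    apply: powR_lt1; rewrite ?invr_gt0// U0 ltr_pdivrMr; lra.
  have /andP[-> /ltW ->//] : 0 < (10 / 11 : R) `^ a^-1 < 1.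
  by apply: powR_lt1; rewrite ?invr_gt0//; lra.
- have /andP[h2 h3] : 0 < (1 - (2 * k)^-1) `^ a^-1 < 1.
    by apply: powR_lt1; rewrite ?invr_gt0.
  by rewrite powRN invf_gt1.
- have w0 : 0 < 10 / 11 :> R by lra.
  rewrite !powRVK//.
  split; last by lra.
  have -> : 1 + 11 / 10 = 21 / 10 :> R by lra.
  rewrite [_ * (_ / (k * (21 / 10) - 1))]mulrC divfK; first by lra.
  by rewrite gt_eqF//; lra.
- rewrite -powRrM mulrNN mulVf ?gt_eqF// powRr1; last by lra.
  rewrite mulrBr mulr1 [k * 2]mulrC divff; first by lra.
  by rewrite gt_eqF//; lra.
Qed.

(** Here a = 1/2 and k = 4, so everything is rational: u = (73/74)^2, w = (10/11)^2, T = (8/7)^2. *)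
Lemma weak_const_1 (R : realType) :
  ((138 / 100 : R)%:E <= weak_const (@Lambda_star R 1) (@L1 R))%E.
Proof.
have kE : (1 + 1%:R) / (1%:R / 2) = 4 :> R by rewrite invf_div divr1; lra.
have aE : (1%:R / 2)^-1 = 2%:R :> R by rewrite invf_div divr1; lra.
have uE : (4 * (21 / 10) - 11 / 10) / (4 * (21 / 10) - 1) = 73 / 74 :> R.
  rewrite (_ : 4 * (21 / 10) - 1 = 74 / 10) ?invf_div; last by lra.
  by lra.
have TE : (1 - (2 * 4)^-1)^-1 = 8 / 7 :> R.
  rewrite (_ : 1 - (2 * 4)^-1 = 7 / 8) ?invf_div//.
  by rewrite -natrM; lra.
have := @schedule_powR R 1 isT; cbv zeta; rewrite kE aE uE powRN.
rewrite !powR_mulrn; [| lra | lra | lra].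
rewrite -exprVn TE => sch; apply: (weak_const_ge_schedule sch); first by lra.
by rewrite !expr2; lra.
Qed.

Lemma weak_const_large (R : realType) (m : nat) : (8 <= m)%N ->
  ((137 / 100 : R)%:E <= weak_const (@Lambda_star R m) (@L1 R))%E.
Proof.
move=> m8; have m0 : (0 < m)%N by exact: leq_trans m8.
have [u [w [T sch]]] : exists u w T, schedule m (11 / 10 : R) u w T.
  by do 3!eexists; exact: schedule_powR.
apply: (weak_const_ge_schedule sch); first by lra.
have [_ [/andP[u0 u1] /andP[w0 w1]] T1 []] := sch.
set a : R := m%:R / 2; set k : R := (_ / a) => uE wE TE.
have a4 : 4 <= a by rewrite ler_pdivlMr// -natrM ler_nat.
have a0 : 0 < a by lra.
(* In fact [k = 2 + 2/m]; only this lower bound and [a >= 4] are used below, which makes the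
   estimates uniform in m. *)
have k2 : 2 <= k.
  by rewrite /k /a invf_div mulrA ler_pdivlMr ?ltr0n// [_ * 2]mulrC ler_pM2l ?lerDr.
clearbody k; clear sch.
have pow4 (x : R) : 0 < x < 1 -> x `^ a <= x ^+ 4.
  move=> /andP[x0 x1]; rewrite -powR_mulrn ?(ltW x0)//.
  by apply: ger_powR => //; rewrite x0 ltW.
have uU : 31 / 32 <= u `^ a.
  have /andP[_ X1] : 0 < u `^ a < 1 by apply: powR_lt1 => //; rewrite u0.
  have := @ler_wpM2r _ (1 - u `^ a) _ _ _ k2; rewrite subr_ge0 => /(_ (ltW X1)).
  by lra.
(* Otherwise [u^a <= u^4 <= 0.99^4 < 31/32]. The bound on [T] below follows likewise from
   [(10/11)^4 < 3/4]. *)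
have u99 : 99 / 100 <= u.
  rewrite leNgt; apply/negP => u99.
  have := pow4 u; rewrite u0 u1 => /(_ isT).
  have : u ^+ 4 <= (99 / 100) ^+ 4.
    by apply: lerXn2r; rewrite ?nnegrE; lra.
  by rewrite !exprS expr0; lra.
have T11 : T <= 11 / 10.
  have T0 : 0 < T by lra.
  have TV : 3 / 4 <= T^-1 `^ a.
    rewrite -(powR_inv1 (ltW T0)) -powRrM mulN1r.
    have : 0 <= T `^ (- a) by exact: powR_ge0.
    move: (T `^ (- a)) TE => z TE z0.
    rewrite leNgt; apply/negP => zlt.
    have h : 0 <= 3 / 4 - z by lra.
    by have := ler_wpM2r h k2; lra.
  rewrite leNgt; apply/negP => T11.
  have TV0 : 0 < T^-1 by rewrite invr_gt0.
  have TV1 : T^-1 < 10 / 11.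
    by rewrite -[10 / 11]invf_div ltf_pV2 ?posrE//; lra.
  have := pow4 T^-1; rewrite TV0 (lt_trans TV1)/=; last by lra.
  move=> /(_ isT).
  have : T^-1 ^+ 4 <= (10 / 11) ^+ 4.
    by apply: lerXn2r; rewrite ?nnegrE; lra.
  by rewrite !exprS expr0; lra.
(* Compare a-th powers: [w^a = 10/11], just below [(31/32)^3]. A period is thus at least four block
   ratios long. *)
have wu3 : w <= u ^+ 3.
  rewrite leNgt; apply/negP => wu3.
  have u3 : 0 <= u ^+ 3 by rewrite exprn_ge0// ltW.
  have : (u ^+ 3) `^ a < w `^ a.
    by apply: (gt0_ltr_powR a0); rewrite ?nnegrE// ltW.
  have -> : (u ^+ 3) `^ a = (u `^ a) ^+ 3.
    by rewrite -!powR_mulrn ?powR_ge0 ?(ltW u0)// powRAC.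
  have : (31 / 32) ^+ 3 <= (u `^ a) ^+ 3 by apply: lerXn2r; rewrite ?nnegrE; lra.
  by rewrite !exprS expr0; lra.
(* [1 - w u >= 1 - u^4 = (1 - u)(1 + u + u^2 + u^3)], and the last factor is at least 3.94 for
   [u >= 0.99]. *)
have D : (1 - u) * (394 / 100) <= 1 - w * u.
  have u98 : (99 / 100) * (99 / 100) <= u * u by apply: ler_pM; lra.
  have u97 : (99 / 100) * (99 / 100) * (99 / 100) <= u * u * u by apply: ler_pM; lra.
  have := ler_wpM2r (ltW u0) wu3; rewrite !exprS expr0 mulr1.
  have h : 394 / 100 <= 1 + u + u * u + u * u * u by lra.
  have u1' : 0 <= 1 - u by lra.
  by have := ler_wpM2l u1' h; lra.
have D0 : 0 < 1 - w * u by lra.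
have h : 0 <= 11 / 10 - T by lra.
by have := mulr_ge0 h (ltW D0); lra.
Qed.

Theorem theorem1p2 (R : realType) :
  exists F : nat -> set (R -> R),
    [/\ (forall m : nat, (0 < m)%N -> F m `<=` @L1 R),
        ((138 / 100 : R)%:E <= weak_const (@Lambda_star R 1) (F 1%N))%E &
        ((137 / 100 : R)%:E <=
           limn_einf (fun m : nat => weak_const (@Lambda_star R m) (F m)))%E].
Proof.
(* All of [L1] is taken as the class for every m; the bound for each [m >= 8] then passes to the
   liminf. *)
exists (fun=> @L1 R); split; [by move=> m _ f | exact: weak_const_1 |].
rewrite limn_einf_lim; apply: lime_ge; first exact: is_cvg_einfs.
near=> n; apply: le_ereal_inf_tmp => _ /= [m nm <-].
apply: weak_const_large; apply: leq_trans nm.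
by near: n; exists 8.
Unshelve. all: by end_near. Qed.
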